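(* Let $u\in\{0,1\}^*$ and $x\in\{0,1\}$. In order to get $\Gamma_{ux}$ one has to take two copies $\Gamma_u^{(0)}$ and $\Gamma_u^{(1)}$ of $\Gamma_u$ and connect by an edge the copies of the vertex $z_{\alpha,u}$: the obtained graph is isomorphic to $\Gamma_{ux}$. Under this isomorphism, the vertex $z_{\alpha,ux}$ is the copy of $z_{\beta,u}$ in $\Gamma_u^{(1-x)}$, the vertex $z_{\beta,ux}$ is the copy of $z_{\gamma,u}$ in $\Gamma_u^{(1)}$, and the vertex $z_{\gamma,ux}$ is the copy of $z_{\gamma,u}$ in $\Gamma_u^{(0)}$.
   Context: For an infinite binary sequence $w=x_1x_2\ldots\in\{0,1\}^\omega$ with shift $\overline w=x_2x_3\ldots$, define automorphisms $\alpha_w,\beta_w,\gamma_w$ of the binary tree $\{0,1\}^*$ recursively by: $\alpha_w(0s)=1s$, $\alpha_w(1s)=0s$; $\gamma_w(0s)=0\gamma_{\overline w}(s)$, $\gamma_w(1s)=1\beta_{\overline w}(s)$; if $x_1=0$ then $\beta_w(0s)=0s$, $\beta_w(1s)=1\alpha_{\overline w}(s)$; if $x_1=1$ then $\beta_w(0s)=0\alpha_{\overline w}(s)$, $\beta_w(1s)=1s$. For $v\in\{0,1\}^n$ the action of $\alpha_w,\beta_w,\gamma_w$ on $\{0,1\}^n$ depends only on the prefix $v$ of $w$; it is denoted $\alpha,\beta,\gamma$, and the set $\{0,1\}^n$ with this action is denoted $E_v$. $\Gamma_v$ is the simplicial (loops are ignored) Schreier graph with vertex set $E_v$ in which $s_1\neq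 s_2$ are adjacent iff $g(s_1)=s_2$ for some $g\in\{\alpha,\beta,\gamma\}$; the edge is labeled by $g$. For $v\in\{0,1\}^n$ with last letter $x$ put $z_{\alpha,v}=0^{n-2}1x'$ with $x'=1-x$, $z_{\beta,v}=0^{n-1}1$, $z_{\gamma,v}=0^n$; if $n<2$ one takes the endings of length $n$ of these words (so $z_{\alpha,v}=x'$ for $n=1$, and all three are the empty word for $n=0$). *)

(* Defs.v *)
From HB Require Import structures.
From mathcomp Require Import all_boot.

Set Implicit Arguments.
Unset Strict Implicit.
Unset Printing Implicit Defensive.

(* Letters are booleans (0 = false, 1 = true), finite words are [seq bool],
   and infinite sequences x_1 x_2 ... are functions [w] with w i = x_(i+1). *)

Definition shift (w : nat -> bool) : nat -> bool := fun i => w i.+1.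

Inductive gen := Alpha | Beta | Gamma.

Definition gen_code (g : gen) : option bool :=
  match g with Alpha => None | Beta => Some false | Gamma => Some true end.
Definition gen_decode (c : option bool) : gen :=
  match c with None => Alpha | Some false => Beta | Some true => Gamma end.
Lemma gen_codeK : cancel gen_code gen_decode. Proof. by case. Qed.
HB.instance Definition _ := Equality.copy gen (can_type gen_codeK).

Definition alpha (w : nat -> bool) (s : seq bool) : seq bool :=
  match s with
  | [::] => [::]
  | false :: t => true :: t
  | true :: t => false :: t
  end.

Definition beta (w : nat -> bool) (s : seq bool) : seq bool :=
  match w 0, s with
  | _, [::] => [::]
  | false, false :: t => false :: t
  | false, true :: t => true :: alpha (shift w) t
  | true, false :: t => false :: alpha (shift w) t
  | true, true :: t => true :: t
  end.

Fixpoint gamma (w : nat -> bool) (s : seq bool) : seq bool :=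
  match s with
  | [::] => [::]
  | false :: t => false :: gamma (shift w) t
  | true :: t => true :: beta (shift w) t
  end.

Definition act (w : nat -> bool) (g : gen) : seq bool -> seq bool :=
  match g with Alpha => alpha w | Beta => beta w | Gamma => gamma w end.

Lemma size_alpha w s : size (alpha w s) = size s.
Proof. by case: s => [|[]]. Qed.

Lemma size_beta w s : size (beta w s) = size s.
Proof. by rewrite /beta; case: (w 0) s => [] [|[] t] //=; rewrite size_alpha. Qed.

Lemma size_act w g s : size (act w g s) = size s.
Proof.
case: g => /=; [exact: size_alpha | exact: size_beta |].
elim: s w => [|[] t IH] w //=; by rewrite ?size_beta ?IH.
Qed.

Lemma alphaK w : involutive (alpha w). Proof. by case=> [|[]]. Qed.

Lemma betaK w : involutive (beta w).
Proof.
by rewrite /beta => s; case: (w 0) s => [] [|[] t] //=; rewrite alphaK.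
Qed.

Lemma actK w g : involutive (act w g).
Proof.
case: g => /=; [exact: alphaK | exact: betaK |] => s.
elim: s w => [|[] t IH] w //=; by rewrite ?betaK ?IH.
Qed.

Lemma act_prefix w1 w2 g s :
  (forall i, i < size s -> w1 i = w2 i) -> act w1 g s = act w2 g s.
Proof.
have Hb v1 v2 t : (forall i, i < size t -> v1 i = v2 i) ->
    beta v1 t = beta v2 t.
  by case: t => [|b t] H; rewrite /beta; [case: (v1 0); case: (v2 0) | rewrite (H 0)].
case: g => //=; first exact: Hb.
elim: s w1 w2 => [|[] t IH] w1 w2 H //=; congr (_ :: _).
  by apply: Hb => i Hi; exact: (H i.+1).
by apply: IH => i Hi; exact: (H i.+1).
Qed.

(* E_v: the words of the same length as v; by [act_prefix] it does not matter
   that v is extended to an infinite sequence by zeros. *)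
Definition E (v : seq bool) : finType := (size v).-tuple bool.

Definition extend (v : seq bool) : nat -> bool := nth false v.

Lemma actE_subproof v g (s : E v) : size (act (extend v) g s) == size v.
Proof. by rewrite size_act size_tuple. Qed.

Definition actE (v : seq bool) (g : gen) (s : E v) : E v :=
  Tuple (actE_subproof g s).

Lemma actE_extension v w g (s : E v) :
  (forall i, i < size v -> w i = nth false v i) ->
  tval (actE g s) = act w g s.
Proof.
by move=> H; apply: act_prefix => i; rewrite size_tuple => /H ->.
Qed.

(* Finite simplicial graphs with edges labeled by elements of L. *)
Record lgraph (L : Type) := LGraph {
  vertex :> finType;
  ledge : L -> rel vertex;
  ledge_sym : forall g, symmetric (ledge g);
  ledge_irr : forall g, irreflexive (ledge g) }.
Arguments ledge {L} _ _ _ _.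

Definition adj (L : Type) (G : lgraph L) (s t : G) : Prop :=
  exists g, ledge G g s t.

Definition lgraph_iso (L : Type) (G H : lgraph L) (phi : G -> H) : Prop :=
  bijective phi /\ forall g s t, ledge H g (phi s) (phi t) = ledge G g s t.

Lemma lgraph_iso_adj (L : Type) (G H : lgraph L) (phi : G -> H) :
  lgraph_iso phi -> forall s t, adj (phi s) (phi t) <-> adj s t.
Proof. by case=> _ He s t; split=> -[g]; rewrite ?He => Hg; exists g; rewrite ?He. Qed.

(* The copy G^(i) consists of the vertices (i, s); the copies (0, z) and (1, z)
   of z are connected by an edge labeled g0. *)
Section Join.
Variables (L : eqType) (G : lgraph L) (z : G) (g0 : L).

Definition join_edge (g : L) (p q : bool * G) : bool :=
  if p.1 == q.1 then ledge G g p.2 q.2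
  else [&& g == g0, p.2 == z & q.2 == z].

Lemma join_edge_sym g : symmetric (join_edge g).
Proof.
case=> i s [j t]; rewrite /join_edge /= eq_sym ledge_sym.
by rewrite (andbC (s == z)).
Qed.

Lemma join_edge_irr g : irreflexive (join_edge g).
Proof. by case=> i s; rewrite /join_edge /= eqxx ledge_irr. Qed.

Definition join_copies : lgraph L :=
  @LGraph L (bool * G)%type join_edge join_edge_sym join_edge_irr.
End Join.

Section Schreier.
Variable v : seq bool.

Definition schreier_edge (g : gen) (s1 s2 : E v) : bool :=
  (s1 != s2) && (actE g s1 == s2).

Lemma schreier_edge_sym g : symmetric (schreier_edge g).
Proof.
have K : involutive (@actE v g) by move=> s; apply: val_inj; exact: actK.
by move=> s t; rewrite /schreier_edge eq_sym (can2_eq K K) (eq_sym s).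
Qed.

Lemma schreier_edge_irr g : irreflexive (schreier_edge g).
Proof. by move=> s; rewrite /schreier_edge eqxx. Qed.

Definition schreier : lgraph gen :=
  LGraph schreier_edge_sym schreier_edge_irr.
End Schreier.

Definition ending (n : nat) (s : seq bool) : seq bool := drop (size s - n) s.

Lemma size_ending n s : n <= size s -> size (ending n s) == n.
Proof. by move=> H; rewrite size_drop subKn. Qed.

(* Subtraction is truncated. When v is empty the last letter is irrelevant,
   since the ending of length 0 is taken. *)
Definition z_word (g : gen) (v : seq bool) : seq bool :=
  match g with
  | Alpha => nseq (size v - 2) false ++ [:: true; ~~ last false v]
  | Beta => nseq (size v - 1) false ++ [:: true]
  | Gamma => nseq (size v) false
  end.

Lemma z_subproof g v : size (ending (size v) (z_word g v)) == size v.
Proof.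
apply: size_ending; case: g; rewrite /= ?size_cat !size_nseq //=.
  by rewrite addnC -leq_subLR.
by rewrite addnC -leq_subLR.
Qed.

Definition z (g : gen) (v : seq bool) : schreier v := Tuple (z_subproof g v).

(* Main.v *)
Require Import Defs.
From mathcomp Require Import all_boot.

(** The isomorphism appends the copy index as a new last letter:
    the vertex [s] of the copy [i] goes to the word [si].

    A generator acts on the first [n = |u|] letters of [si] as it does on [s],
    so everything depends on when it changes the last letter [i]. Only [alpha]
    ever changes a letter, so this happens iff the section of the generator at
    [s] is [alpha]. The recursion reaches [alpha] along a single path: [gamma]
    stays [gamma] while it reads [0], becomes [beta] on reading [1], and [beta]
    becomes [alpha] on reading the complement of the current letter of [w].
    Hence for each [n] exactly one generator [g] has the section [alpha] at
    a word of length [n], and at one such word only: [alpha] at the empty word,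
    [beta] at [x'], and [gamma] at [0^(n-2) 1 x'] ([act_rcons]). This word is
    [z_alpha] for [u], and it is fixed by [g] ([act_last_flip_word]). So [g]
    contributes no edge at [z_alpha] inside the two copies, and exactly one
    edge, between the two copies of [z_alpha], across them. All the other edges
    are those of the two copies. *)

(** The generator whose section at some word of length [n] is [alpha]. *)
Definition last_flip_gen (n : nat) : gen :=
  match n with 0 => Alpha | 1 => Beta | _ => Gamma end.

Definition last_flip_word (w : nat -> bool) (n : nat) : seq bool :=
  match n with
  | 0 => [::]
  | 1 => [:: ~~ w 0]
  | m.+2 => nseq m false ++ [:: true; ~~ w m.+1]
  end.

(** Taking endings in the definition of [z_alpha] is what makes the words for
    [n = 0] and [n = 1] agree as well. *)
Lemma last_flip_word_ending v :
  last_flip_word (extend v) (size v) = ending (size v) (z_word Alpha v).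
Proof.
rewrite /ending /= size_cat size_nseq /= /extend.
have -> : last false v = nth false v (size v).-1 by rewrite nth_last.
case: (size v) => [|[|m]] //=.
by rewrite -{2}[m.+2](addn2 m) !subSS subn0 addn2 subnn drop0.
Qed.

Lemma act_last_flip_word w n :
  act w (last_flip_gen n) (last_flip_word w n) = last_flip_word w n.
Proof.
case: n => [|[|m]] //=; first by rewrite /beta; case: (w 0).
elim: m w => [|m IH] w /=.
  by rewrite /beta /shift; case: (w 1).
by congr (_ :: _); exact: IH.
Qed.

Lemma beta_rcons w s i :
  beta w (rcons s i) = rcons (beta w s) (i (+) (s == [:: ~~ w 0])).
Proof.
by rewrite /beta; case: (w 0) s i => [] [|[] [|[] s]] [].
Qed.

(** The last letter is acted on by the section of [g] at [s], and a one-letter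
    word is moved by [alpha] only; the boolean added to [i] says that this section
    is [alpha]. *)
Lemma act_rcons w g s i :
  act w g (rcons s i) =
  rcons (act w g s)
    (i (+) ((g == last_flip_gen (size s)) && (s == last_flip_word w (size s)))).
Proof.
case: g => /=.
- by case: s i => [|[] [|b s]] [].
- by rewrite beta_rcons; case: s => [|b1 [|b2 s]] //=;
    rewrite eqseq_cons andbF.
elim: s w => [|[] s IH] w /=; first by case: i; rewrite //= /beta; case: (shift w 0).
  rewrite beta_rcons; case: s {IH} => [|b [|c s]] //=.
  by rewrite !eqseq_cons andbF.
by rewrite IH; case: s {IH} => [|b [|c s]].
Qed.

Lemma actE_rcons u x g (s : E u) i :
  act (extend (rcons u x)) g (rcons s i) =
  rcons (actE g s)
    (i (+) ((g == last_flip_gen (size u)) && (s == z Alpha u))).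
Proof.
have ext k : k < size u -> extend (rcons u x) k = nth false u k.
  by move=> lt_k; rewrite /extend nth_rcons lt_k.
rewrite act_rcons -(actE_extension _ _ ext) size_tuple -val_eqE /=.
rewrite -[ending _ _]last_flip_word_ending.
suff -> : last_flip_word (extend (rcons u x)) (size u) =
          last_flip_word (extend u) (size u) by [].
by case: (size u) ext => [|[|m]] ext; rewrite /last_flip_word ?ext.
Qed.

Lemma actE_z_Alpha u : actE (last_flip_gen (size u)) (z Alpha u) = z Alpha u.
Proof.
apply: val_inj => /=.
by rewrite -[ending _ _]last_flip_word_ending act_last_flip_word.
Qed.

Section AppendCopyIndex.
Variables (u : seq bool) (x : bool).

Let copies := join_copies (z Alpha u) (last_flip_gen (size u)).

Lemma size_append (p : copies) :
  size (rcons (tval p.2) p.1) == size (rcons u x).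
Proof. by rewrite !size_rcons size_tuple. Qed.

Definition append_index (p : copies) : schreier (rcons u x) :=
  Tuple (size_append p).

Lemma append_index_inj : injective append_index.
Proof.
by move=> [i s] [j t] /(congr1 val) /= /rcons_inj [] /val_inj -> ->.
Qed.

Lemma append_index_bij : bijective append_index.
Proof.
apply: (inj_card_bij append_index_inj).
by rewrite card_prod !card_tuple card_bool size_rcons expnS.
Qed.

Lemma append_index_edge g (p q : copies) :
  ledge (schreier (rcons u x)) g (append_index p) (append_index q) =
  ledge copies g p q.
Proof.
case: p q => i s [j t].
rewrite /= /schreier_edge /join_edge /= (inj_eq append_index_inj).
rewrite -val_eqE /= actE_rcons eqseq_rcons val_eqE xpair_eqE.
have [/andP[/eqP -> /eqP ->]|no_flip] /= := boolP ((g == _) && _).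
  (* Here [g] fixes [s] and flips the index, so [j] is forced to be [~~ i]. *)
  rewrite actE_z_Alpha /schreier_edge actE_z_Alpha !eqxx [t == _]eq_sym.
  by case: i j (z Alpha u == t) => [] [] [].
rewrite addbF /schreier_edge [X in if _ then _ else X]andbA (negbTE no_flip).
by case: (i == j); rewrite ?andbT ?andbF.
Qed.

Lemma append_index_iso : lgraph_iso append_index.
Proof. by split; [exact: append_index_bij | exact: append_index_edge]. Qed.

End AppendCopyIndex.

Theorem corollary3p11 (u : seq bool) (x : bool) :
  exists (g : gen)
    (phi : join_copies (z Alpha u) g -> schreier (rcons u x)),
    [/\ lgraph_iso phi,
        phi (~~ x, z Beta u) = z Alpha (rcons u x),
        phi (true, z Gamma u) = z Beta (rcons u x)
      & phi (false, z Gamma u) = z Gamma (rcons u x)].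
Proof.
exists (last_flip_gen (size u)), (append_index u x).
split; first exact: append_index_iso; apply: val_inj;
  rewrite /= /ending ?size_cat !size_nseq size_rcons ?last_rcons /=.
- case: (size u) => [|m] //=.
  by rewrite !subSS !subn0 addn1 addn2 !subnn !drop0 -cats1 -catA.
- by rewrite !subSS !subn0 addn1 !subnn !drop0 cats1.
by rewrite !subnn !drop0 -[RHS]/(nseq (size u).+1 false) -addn1 nseqD cats1.
Qed.
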